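(* Let $k$ be a field of characteristic $p$, let $\mathcal{M}, \mathcal{N}$ be prestacks, let $\mathcal{F}:\mathcal{M}\to\mathcal{N}$ be a natural transformation, let $X \in \mathcal{M}(k)$, and let $G \subseteq \mathrm{Aut}_k(X)$. If the induced functor $\mathrm{Def}_X^{\star} \to \mathrm{Def}_{\mathcal{F}(X)}^{\star}$ is an equivalence and $\mathcal{F}$ is $G$-equivariant, then $\mathrm{Def}_X^G$ and $\mathrm{Def}_{\mathcal{F}(X)}^G$ are equivalent: $\mathrm{Def}_X^G \simeq \mathrm{Def}_{\mathcal{F}(X)}^G$.
   Context: $\widehat{\mathsf{Art}}_k$ is the category of complete local algebras with finitely generated maximal ideal and a specified map to the residue field $k$. Prestacks here are functors $\widehat{\mathsf{Art}}_k\to \mathrm{Grpd}$. For $\mathfrak{X}$ over $R$, $\mathfrak{X}|_k$ denotes its base change along $R\to k$. For a prestack $\mathcal{M}$, $X\in\mathcal{M}(k)$ and $G\subseteq \mathrm{Aut}_k(X)$, the deformation functor $\mathrm{Def}^G_X:\widehat{\mathsf{Art}}_k\to\mathrm{Grpd}$ sends $R$ to the groupoid whose objects are pairs $(\mathfrak{X}\in\mathcal{M}(R),\ \iota:\mathfrak{X}|_k\simeq X)$ and whose morphisms $(\mathfrak{X},\iota)\to(\mathfrak{X}',\iota')$ are maps $\phi:\mathfrak{X}\to\mathfrak{X}'$ such that there exists $g\in G$ with $\iota'\circ\phi|_k=g\circ\iota$. Put $\mathrm{Def}^\star_X:=\mathrm{Def}^{\{\mathrm{id}\}}_X$. For $\mathcal{F}(X)\in\mathcal{N}(k)$,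 the deformation functors $\mathrm{Def}_{\mathcal{F}(X)}$ are formed in $\mathcal{N}$. The group $G$ acts on $\mathrm{Def}_X^\star$ by sending an object $(\mathfrak{X},\iota)$ to $(\mathfrak{X},g\circ\iota)$ and a morphism $\phi$ to itself. $\mathcal{F}$ induces a functor $\widetilde{\mathcal{F}}:\mathrm{Def}_X\to\mathrm{Def}_{\mathcal{F}(X)}$. ''$\mathcal F$ is $G$-equivariant'' means that $G$ is preserved under $\mathcal{F}$: the map $\mathrm{Aut}_k(X)\to\mathrm{Aut}_k(\mathcal{F}(X))$ restricts to an isomorphism from $G$ onto a subgroup of $\mathrm{Aut}_k(\mathcal{F}(X))$, again denoted $G$, and $\widetilde{\mathcal{F}}$ is compatible with the resulting actions. *)

(* Defs.v *)
From HB Require Import structures.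
From mathcomp Require Import all_boot all_order all_algebra.
From mathcomp Require Import boolp classical_sets functions.

Set Implicit Arguments.
Unset Strict Implicit.
Unset Printing Implicit Defensive.

Import GRing.Theory.

Local Open Scope ring_scope.

#[local] Obligation Tactic := try by [].

Record category := Category {
  obj :> Type;
  hom : obj -> obj -> Type;
  idm : forall x, hom x x;
  comp : forall x y z, hom y z -> hom x y -> hom x z;
  compA : forall x y z t (h : hom z t) (g : hom y z) (f : hom x y),
    comp h (comp g f) = comp (comp h g) f;
  comp1m : forall x y (f : hom x y), comp (idm y) f = f;
  compm1 : forall x y (f : hom x y), comp f (idm x) = f
}.
Arguments hom {_} _ _.
Arguments idm {_} _.
Arguments comp {_ x y z} _ _.

Notation "g <o> f" := (comp g f) (at level 40, left associativity).

Record functor (A B : category) := Functor {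
  fob :> A -> B;
  fmap : forall x y, hom x y -> hom (fob x) (fob y);
  fmap1 : forall x, fmap (idm x) = idm (fob x);
  fmapM : forall x y z (g : hom y z) (f : hom x y),
    fmap (g <o> f) = fmap g <o> fmap f
}.
Arguments fmap {A B} _ {x y} _.

Program Definition functor_id (A : category) : functor A A :=
  {| fob := fun x => x; fmap := fun _ _ f => f |}.

Program Definition functor_comp (A B C : category)
    (T : functor B C) (S : functor A B) : functor A C :=
  {| fob := fun x => T (S x); fmap := fun _ _ f => fmap T (fmap S f) |}.
Next Obligation. by move=> *; rewrite /= !fmap1. Qed.
Next Obligation. by move=> *; rewrite /= !fmapM. Qed.

Record groupoid := Groupoid {
  gcat :> category;
  ginv : forall x y : gcat, hom x y -> hom y x;
  ginvl : forall (x y : gcat) (f : hom x y), ginv f <o> f = idm x;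
  ginvr : forall (x y : gcat) (f : hom x y), f <o> ginv f = idm y
}.
Arguments ginv {_ x y} _.

(* Subgroups of Aut(X); in a groupoid every endomorphism is an automorphism. *)
Record subgroup (A : groupoid) (X : A) := Subgroup {
  sgset :> set (hom X X);
  sg1 : sgset (idm X);
  sgM : forall g h, sgset g -> sgset h -> sgset (g <o> h);
  sgV : forall g, sgset g -> sgset (ginv g)
}.

Lemma ginv_uniq (A : groupoid) (x y : A) (f : hom x y) (g : hom y x) :
  g <o> f = idm x -> g = ginv f.
Proof. by move=> gf; rewrite -[g]compm1 -(ginvr f) compA gf comp1m. Qed.

Lemma fmapV (A B : groupoid) (T : functor A B) (x y : A) (f : hom x y) :
  fmap T (ginv f) = ginv (fmap T f).
Proof. by apply: ginv_uniq; rewrite -fmapM ginvl fmap1. Qed.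

Program Definition subgroup1 (A : groupoid) (X : A) : subgroup X :=
  {| sgset := [set idm X] |}.
Next Obligation. by rewrite /= => A X _ _ -> ->; rewrite comp1m. Qed.
Next Obligation. by move=> A X _ /= ->; apply/esym/ginv_uniq/comp1m. Qed.

Program Definition subgroup_image (A B : groupoid) (T : functor A B) (X : A)
    (G : subgroup X) : subgroup (T X) :=
  {| sgset := [set fmap T g | g in G] |}.
Next Obligation. by move=> A B T X G; exists (idm X); [exact: sg1 | exact: fmap1]. Qed.
Next Obligation.
move=> A B T X G _ _ [g Gg <-] [h Gh <-].
by exists (g <o> h); [exact: sgM | exact: fmapM].
Qed.
Next Obligation.
by move=> A B T X G _ [g Gg <-]; exists (ginv g); [exact: sgV | exact: fmapV].
Qed.

(* The transformation P f => P g induced by an equality f = g. *)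
Definition fam_eq (C : category) (P : C -> groupoid)
    (F : forall R S : C, hom R S -> functor (P R) (P S))
    (R S : C) (f g : hom R S) (e : f = g) (x : P R) : hom (F R S f x) (F R S g x) :=
  match e in _ = h return hom (F R S f x) (F R S h x) with
  | erefl => idm _
  end.
Arguments fam_eq {C P} F {R S f g} e x.

(* "Functor C -> Grpd" is taken in the 2-categorical sense: base change is
   functorial up to coherent isomorphism. Strict functors are the case where
   punit and pcomp are given by equalities of objects. *)
Record prestack (C : category) := Prestack {
  pob :> C -> groupoid;
  pmap : forall R S : C, hom R S -> functor (pob R) (pob S);
  punit : forall (R : C) (x : pob R), hom (pmap (idm R) x) x;
  pcomp : forall (R S T : C) (g : hom S T) (f : hom R S) (x : pob R),
    hom (pmap g (pmap f x)) (pmap (g <o> f) x);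
  punit_nat : forall (R : C) (x y : pob R) (phi : hom x y),
    punit y <o> fmap (pmap (idm R)) phi = phi <o> punit x;
  pcomp_nat : forall (R S T : C) (g : hom S T) (f : hom R S)
      (x y : pob R) (phi : hom x y),
    pcomp g f y <o> fmap (pmap g) (fmap (pmap f) phi)
    = fmap (pmap (g <o> f)) phi <o> pcomp g f x;
  pcomp1m : forall (R S : C) (f : hom R S) (x : pob R),
    fam_eq pmap (comp1m f) x <o> pcomp (idm S) f x = punit (pmap f x);
  pcompm1 : forall (R S : C) (f : hom R S) (x : pob R),
    fam_eq pmap (compm1 f) x <o> pcomp f (idm R) x = fmap (pmap f) (punit x);
  pcompA : forall (R S T U : C) (h : hom T U) (g : hom S T) (f : hom R S)
      (x : pob R),
    fam_eq pmap (compA h g f) x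
      <o> (pcomp h (g <o> f) x <o> fmap (pmap h) (pcomp g f x))
    = pcomp (h <o> g) f x <o> pcomp h g (pmap f x)
}.
Arguments pmap {C} _ {R S} _.
Arguments punit {C _ R} _.
Arguments pcomp {C _ R S T} _ _ _.

Record pstrans (C : category) (P Q : prestack C) := Pstrans {
  tob :> forall R : C, functor (P R) (Q R);
  tnat : forall (R S : C) (f : hom R S) (x : P R),
    hom (pmap Q f (tob R x)) (tob S (pmap P f x));
  tnat_nat : forall (R S : C) (f : hom R S) (x y : P R) (phi : hom x y),
    tnat f y <o> fmap (pmap Q f) (fmap (tob R) phi)
    = fmap (tob S) (fmap (pmap P f) phi) <o> tnat f x;
  tnat1 : forall (R : C) (x : P R),
    fmap (tob R) (punit x) <o> tnat (idm R) x = punit (tob R x);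
  tnatM : forall (R S T : C) (g : hom S T) (f : hom R S) (x : P R),
    tnat (g <o> f) x <o> pcomp g f (tob R x)
    = fmap (tob T) (pcomp g f x)
        <o> (tnat g (pmap P f x) <o> fmap (pmap Q g) (tnat f x))
}.
Arguments tnat {C P Q} _ {R S} _ _.

Program Definition pstrans_id (C : category) (P : prestack C) : pstrans P P :=
  {| tob := fun R => functor_id (P R); tnat := fun _ _ _ _ => idm _ |}.
Next Obligation. by move=> *; rewrite comp1m compm1. Qed.
Next Obligation. by move=> *; rewrite compm1. Qed.
Next Obligation. by move=> *; rewrite /= fmap1 !comp1m compm1. Qed.

Program Definition pstrans_comp (C : category) (P Q O : prestack C)
    (T : pstrans Q O) (S : pstrans P Q) : pstrans P O :=
  {| tob := fun R => functor_comp (T R) (S R);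
     tnat := fun _ R f x => fmap (T R) (tnat S f x) <o> tnat T f (S _ x) |}.
Next Obligation.
move=> C P Q O T S R R' f x y phi /=.
by rewrite -compA tnat_nat !compA -!fmapM tnat_nat.
Qed.
Next Obligation.
by move=> C P Q O T S R x /=; rewrite compA -fmapM tnat1 tnat1.
Qed.
Next Obligation.
move=> C P Q O T S R1 R2 R3 g f x /=.
rewrite -compA tnatM !compA -fmapM tnatM 2!fmapM fmapM -!compA.
by congr (_ <o> (_ <o> _)); rewrite !compA; congr (_ <o> _); rewrite tnat_nat.
Qed.

(* 2-morphisms of prestacks; they are invertible, since their components are. *)
Record modification (C : category) (P Q : prestack C) (T T' : pstrans P Q) :=
  Modification {
  mob : forall (R : C) (x : P R), hom (T R x) (T' R x);
  mob_nat : forall (R : C) (x y : P R) (phi : hom x y),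
    mob y <o> fmap (T R) phi = fmap (T' R) phi <o> mob x;
  mob_tnat : forall (R S : C) (f : hom R S) (x : P R),
    mob (pmap P f x) <o> tnat T f x = tnat T' f x <o> fmap (pmap Q f) (mob x)
}.

Definition is_equivalence (C : category) (P Q : prestack C) (T : pstrans P Q) :=
  exists S : pstrans Q P,
    inhabited (modification (pstrans_comp S T) (pstrans_id P)) /\
    inhabited (modification (pstrans_comp T S) (pstrans_id Q)).

Definition equivalent (C : category) (P Q : prestack C) :=
  exists T : pstrans P Q, is_equivalence T.

Section Ideals.
Variable R : comNzRingType.

(* idealr_closed only holds of proper ideals. *)
Definition maximal_ideal (I : {pred R}) : Prop :=
  idealr_closed I /\
  forall J : {pred R}, idealr_closed J -> {subset I <= J} -> J =i I.

Definition local_with_max (I : {pred R}) : Prop :=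
  maximal_ideal I /\ forall J : {pred R}, maximal_ideal J -> J =i I.

Definition fin_gen_ideal (I : {pred R}) : Prop :=
  exists (n : nat) (g : 'I_n -> R),
    forall x, x \in I <-> exists c : 'I_n -> R, x = \sum_(i < n) c i * g i.

Fixpoint ideal_pow (I : {pred R}) (n : nat) : set R :=
  if n is m.+1 then
    [set x | exists2 s : seq (R * R),
       forall u, u \in s -> u.1 \in I /\ ideal_pow I m u.2 &
       x = \sum_(u <- s) u.1 * u.2]
  else setT.

(* R -> lim_n R / I^n is injective and surjective. *)
Definition adic_complete (I : {pred R}) : Prop :=
  (forall x, (forall n, ideal_pow I n x) -> x = 0) /\
  (forall u : nat -> R, (forall n, ideal_pow I n (u n.+1 - u n)) ->
     exists l, forall n, ideal_pow I n (l - u n)).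

End Ideals.

Section Art.

(* Algebras are algebras over a base ring L, of which k is itself an algebra
   through str_k. For L = int these are just rings; other choices are L = k and
   L a Cohen ring of k. *)
Variables (L : comNzRingType) (k : fieldType) (str_k : {rmorphism L -> k}).

Record artAlg := ArtAlg {
  art_ring :> comNzRingType;
  art_str : {rmorphism L -> art_ring};
  art_res : {rmorphism art_ring -> k};
  art_res_str : forall c, art_res (art_str c) = str_k c;
  art_res_surj : forall y, exists x, art_res x = y;
  art_local : local_with_max [pred x | art_res x == 0];
  art_fingen : fin_gen_ideal [pred x | art_res x == 0];
  art_complete : adic_complete [pred x | art_res x == 0]
}.

(* Such maps are local: preservation of maximal ideals follows from artm_res. *)
Record artHom (A B : artAlg) := ArtHom {
  artm :> {rmorphism A -> B};
  artm_str : forall c, artm (art_str A c) = art_str B c;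
  artm_res : forall x, art_res B (artm x) = art_res A x
}.

Lemma rmorphism_ext (A B : comNzRingType) (f g : {rmorphism A -> B}) :
  f =1 g -> f = g.
Proof.
move=> fg; have {fg} : (f : A -> B) = g by apply/funext.
case: f g => f [[f1] [f2]] [g [[g1] [g2]]] /= fg.
case: _ / fg g1 g2 => g1 g2.
by rewrite (Prop_irrelevance f1 g1) (Prop_irrelevance f2 g2).
Qed.

Lemma artHom_ext (A B : artAlg) (f g : artHom A B) : f =1 g -> f = g.
Proof.
case: f g => f f1 f2 [g g1 g2] /= /rmorphism_ext fg.
case: _ / fg g1 g2 => g1 g2.
by rewrite (Prop_irrelevance f1 g1) (Prop_irrelevance f2 g2).
Qed.

Program Definition artHom_id (A : artAlg) : artHom A A :=
  {| artm := idfun |}.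

Program Definition artHom_comp (A B D : artAlg) (g : artHom B D) (f : artHom A B) :
    artHom A D :=
  {| artm := (g \o f : {rmorphism A -> D}) |}.
Next Obligation. by move=> A B D g f c; rewrite /= !artm_str. Qed.
Next Obligation. by move=> A B D g f c; rewrite /= !artm_res. Qed.

Program Definition Art : category :=
  {| obj := artAlg; hom := artHom; idm := artHom_id; comp := artHom_comp |}.
Next Obligation. by move=> *; apply: artHom_ext. Qed.
Next Obligation. by move=> *; apply: artHom_ext. Qed.
Next Obligation. by move=> *; apply: artHom_ext. Qed.

Lemma field_maximal0 : maximal_ideal [pred x : k | idfun x == 0].
Proof.
split=> [|J [J0 J1 JD] _ x].
  split=> [||a x y]; rewrite !inE ?eqxx ?oner_eq0 //.
  by move=> /eqP/= -> /eqP/= ->; rewrite mulr0 addr0.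
rewrite !inE /=; have [->//|x0] := eqVneq x 0; apply: contraNF J1 => Jx.
by rewrite -(mulVf x0) -[_ * _]addr0 JD.
Qed.

Lemma field_local0 : local_with_max [pred x : k | idfun x == 0].
Proof.
split=> [|J [JI Jmax] x]; first exact: field_maximal0.
case: field_maximal0 => I0 Imax; apply: Imax => // y.
by rewrite inE => /eqP/= ->; case: JI => -[].
Qed.

Lemma field_fingen0 : fin_gen_ideal [pred x : k | idfun x == 0].
Proof.
exists 0%N, (fun=> 0) => x; rewrite !inE; split=> [/eqP/= ->|[c]].
  by exists (fun=> 0); rewrite big_ord0.
by rewrite big_ord0 => ->.
Qed.

Lemma field_pow0 n x : ideal_pow [pred x : k | idfun x == 0] n.+1 x <-> x = 0.
Proof.
split=> [[s sI ->]|->]; last by exists [::]; rewrite ?big_nil.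
rewrite big_seq big1// => u /sI[].
by rewrite inE => /eqP /= -> _; rewrite mul0r.
Qed.

Lemma field_complete0 : adic_complete [pred x : k | idfun x == 0].
Proof.
split=> [x /(_ 1%N) /field_pow0 //|u uP].
exists (u 1%N) => -[//|n]; apply/field_pow0.
elim: n => [|n IH]; first by rewrite subrr.
move/field_pow0/eqP: (uP n.+1); rewrite subr_eq0 => /eqP ->; exact: IH.
Qed.

Definition art_k : Art := @ArtAlg k str_k idfun (fun=> erefl)
  (fun y => ex_intro _ y erefl) field_local0 field_fingen0 field_complete0.

Definition to_k (R : Art) : @hom Art R art_k :=
  @ArtHom R art_k (art_res R) (@art_res_str R) (fun=> erefl).

Lemma to_k_comp (R S : Art) (f : hom R S) : to_k S <o> f = to_k R.
Proof. by apply: artHom_ext => x; apply: artm_res. Qed.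

(* The comparison (f_* x)|_k -> x|_k. *)
Definition base_change_k (M : prestack Art) (R S : Art) (f : hom R S) (x : M R) :
    hom (pmap M (to_k S) (pmap M f x)) (pmap M (to_k R) x) :=
  fam_eq (@pmap _ M) (to_k_comp f) x <o> pcomp (to_k S) f x.

Section BaseChange.
Variable M : prestack Art.

Lemma fam_eq_nat (R S : Art) (f g : hom R S) (e : f = g) (x y : M R) (phi : hom x y) :
  fam_eq (@pmap _ M) e y <o> fmap (pmap M f) phi
  = fmap (pmap M g) phi <o> fam_eq (@pmap _ M) e x.
Proof. by case: _ / e; rewrite /= comp1m compm1. Qed.

Lemma base_change_k_nat (R S : Art) (f : hom R S) (x y : M R) (phi : hom x y) :
  base_change_k f y <o> fmap (pmap M (to_k S)) (fmap (pmap M f) phi)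
  = fmap (pmap M (to_k R)) phi <o> base_change_k f x.
Proof. by rewrite -compA pcomp_nat !compA fam_eq_nat. Qed.

Lemma base_change_k1 (R : Art) (x : M R) :
  base_change_k (idm R) x = fmap (pmap M (to_k R)) (punit x).
Proof. by rewrite -pcompm1 /base_change_k; congr (fam_eq _ _ _ <o> _). Qed.

Lemma base_change_kM (R S T : Art) (g : hom S T) (f : hom R S) (x : M R) :
  base_change_k (g <o> f) x <o> fmap (pmap M (to_k T)) (pcomp g f x)
  = base_change_k f x <o> base_change_k g (pmap M f x).
Proof.
have gen (h : hom S art_k) (l : hom R art_k)
    (e1 : to_k T <o> g = h) (e2 : h <o> f = l) (e3 : to_k T <o> (g <o> f) = l) :
  fam_eq (@pmap _ M) e3 x <o> pcomp (to_k T) (g <o> f) x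
    <o> fmap (pmap M (to_k T)) (pcomp g f x)
  = fam_eq (@pmap _ M) e2 x <o> pcomp h f x
    <o> (fam_eq (@pmap _ M) e1 (pmap M f x) <o> pcomp (to_k T) g (pmap M f x)).
  subst h l; rewrite /= !comp1m -pcompA -!compA.
  by congr (fam_eq _ _ _ <o> _).
exact: (gen _ _ (to_k_comp g) (to_k_comp f)).
Qed.

End BaseChange.

Section Def.
Variables (M : prestack Art) (X : M art_k) (G : subgroup X).

Record def_obj (R : Art) := DefObj {
  def_val :> M R;
  def_iota : hom (pmap M (to_k R) def_val) X
}.

Record def_hom (R : Art) (x y : def_obj R) := DefHom {
  def_map :> hom (def_val x) (def_val y);
  def_mapP : exists2 g, sgset G g &
    def_iota y <o> fmap (pmap M (to_k R)) def_map = g <o> def_iota x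
}.

Lemma def_hom_ext (R : Art) (x y : def_obj R) (u v : def_hom x y) :
  def_map u = def_map v -> u = v.
Proof.
case: u v => u u1 [v v1] /= uv; case: _ / uv v1 => v1.
by rewrite (Prop_irrelevance u1 v1).
Qed.

Program Definition def_id (R : Art) (x : def_obj R) : def_hom x x :=
  {| def_map := idm (def_val x) |}.
Next Obligation.
by move=> R x; exists (idm X); [exact: sg1 | rewrite fmap1 comp1m compm1].
Qed.

Program Definition def_comp (R : Art) (x y z : def_obj R)
    (v : def_hom y z) (u : def_hom x y) : def_hom x z :=
  {| def_map := def_map v <o> def_map u |}.
Next Obligation.
move=> R x y z [v [h Gh hv]] [u [g Gg gu]] /=; exists (h <o> g); first exact: sgM.
by rewrite fmapM compA hv -compA gu compA.
Qed.

Program Definition def_inv (R : Art) (x y : def_obj R) (u : def_hom x y) :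
    def_hom y x :=
  {| def_map := ginv (def_map u) |}.
Next Obligation.
move=> R x y [u [g Gg gu]] /=; exists (ginv g); first exact: sgV.
have -> : def_iota x = ginv g <o> (def_iota y <o> fmap (pmap M (to_k R)) u).
  by rewrite gu compA ginvl comp1m.
by rewrite -!compA -fmapM ginvr fmap1 compm1.
Qed.

Program Definition def_cat (R : Art) : category :=
  {| obj := def_obj R; hom := @def_hom R; idm := @def_id R; comp := @def_comp R |}.
Next Obligation. by move=> *; apply: def_hom_ext; apply: compA. Qed.
Next Obligation. by move=> *; apply: def_hom_ext; apply: comp1m. Qed.
Next Obligation. by move=> *; apply: def_hom_ext; apply: compm1. Qed.

Program Definition def_groupoid (R : Art) : groupoid :=
  {| gcat := def_cat R; ginv := @def_inv R |}.
Next Obligation. by move=> *; apply: def_hom_ext; apply: ginvl. Qed.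
Next Obligation. by move=> *; apply: def_hom_ext; apply: ginvr. Qed.

Program Definition def_pmap (R S : Art) (f : hom R S) :
    functor (def_groupoid R) (def_groupoid S) :=
  {| fob := fun x : def_obj R =>
       @DefObj S (pmap M f (def_val x)) (def_iota x <o> base_change_k f (def_val x));
     fmap := fun _ _ u => {| def_map := fmap (pmap M f) (def_map u) |} |}.
Next Obligation.
move=> R S f x y [u [g Gg gu]] /=; exists g => //.
by rewrite -compA base_change_k_nat !compA gu.
Qed.
Next Obligation. by move=> *; apply: def_hom_ext; apply: fmap1. Qed.
Next Obligation. by move=> *; apply: def_hom_ext; apply: fmapM. Qed.

Program Definition def_punit (R : Art) (x : def_groupoid R) :
    @hom (def_groupoid R) (def_pmap (idm R) x) x :=
  {| def_map := @punit _ M R (def_val x) |}.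
Next Obligation.
by move=> R x; exists (idm X); [exact: sg1 | rewrite /= base_change_k1 comp1m].
Qed.

Program Definition def_pcomp (R S T : Art) (g : hom S T) (f : hom R S)
    (x : def_groupoid R) :
    @hom (def_groupoid T) (def_pmap g (def_pmap f x)) (def_pmap (g <o> f) x) :=
  {| def_map := @pcomp _ M R S T g f (def_val x) |}.
Next Obligation.
move=> R S T g f x; exists (idm X); first exact: sg1.
by rewrite /= -compA base_change_kM comp1m compA.
Qed.

Lemma def_fam_eq (R S : Art) (f g : hom R S) (e : f = g) (x : def_groupoid R) :
  def_map (fam_eq def_pmap e x) = fam_eq (@pmap _ M) e (def_val x).
Proof. by case: _ / e. Qed.

Program Definition Def : prestack Art :=
  {| pob := def_groupoid; pmap := def_pmap; punit := def_punit; pcomp := def_pcomp |}.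
Next Obligation. by move=> *; apply: def_hom_ext; apply: punit_nat. Qed.
Next Obligation. by move=> *; apply: def_hom_ext; apply: pcomp_nat. Qed.
Next Obligation.
by move=> *; apply: def_hom_ext; rewrite /= def_fam_eq; apply: pcomp1m.
Qed.
Next Obligation.
by move=> *; apply: def_hom_ext; rewrite /= def_fam_eq; apply: pcompm1.
Qed.
Next Obligation.
by move=> *; apply: def_hom_ext; rewrite /= def_fam_eq; apply: pcompA.
Qed.

End Def.

Definition Def_star (M : prestack Art) (X : M art_k) : prestack Art :=
  Def (subgroup1 X).

Program Definition Def_act (M : prestack Art) (X : M art_k) (g : hom X X) (R : Art) :
    functor (Def_star X R) (Def_star X R) :=
  {| fob := fun x : def_obj X R => DefObj (g <o> def_iota x);
     fmap := fun x y (u : def_hom (subgroup1 X) x y) =>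
       {| def_map := def_map u |} |}.
Next Obligation.
move=> M X g R x y u; case: (def_mapP u) => _ -> hu; exists (idm X) => //=.
by rewrite -compA hu !comp1m.
Qed.
Next Obligation. by move=> *; apply: def_hom_ext. Qed.
Next Obligation. by move=> *; apply: def_hom_ext. Qed.

Section Induced.
Variables (M N : prestack Art) (F : pstrans M N) (X : M art_k).

Lemma tnat_base_change_k (R S : Art) (f : hom R S) (x : M R) :
  fmap (F art_k) (base_change_k f x)
    <o> (tnat F (to_k S) (pmap M f x) <o> fmap (pmap N (to_k S)) (tnat F f x))
  = tnat F (to_k R) x <o> base_change_k f (F R x).
Proof.
rewrite /base_change_k fmapM -compA -tnatM !compA; congr (_ <o> _).
by case: _ / (to_k_comp f); rewrite /= fmap1 comp1m compm1.
Qed.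

Variables (G : subgroup X) (H : subgroup (F art_k X)).
Hypothesis GH : forall g, sgset G g -> sgset H (fmap (F art_k) g).

Program Definition def_tob (R : Art) : functor (Def G R) (Def H R) :=
  {| fob := fun x : def_obj X R =>
       @DefObj N (F art_k X) R (F R (def_val x))
         (fmap (F art_k) (def_iota x) <o> tnat F (to_k R) (def_val x));
     fmap := fun _ _ u => {| def_map := fmap (F R) (def_map u) |} |}.
Next Obligation.
move=> R x y [u [g Gg gu]] /=; exists (fmap (F art_k) g); first exact: GH.
by rewrite -compA tnat_nat !compA -!fmapM gu.
Qed.
Next Obligation. by move=> *; apply: def_hom_ext; apply: fmap1. Qed.
Next Obligation. by move=> *; apply: def_hom_ext; apply: fmapM. Qed.

Program Definition def_tnat (R S : Art) (f : hom R S) (x : Def G R) :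
    hom (pmap (Def H) f (def_tob R x)) (def_tob S (pmap (Def G) f x)) :=
  {| def_map := tnat F f (def_val x) |}.
Next Obligation.
move=> R S f x; exists (idm (F art_k X)); first exact: sg1.
by rewrite /= comp1m fmapM -!compA tnat_base_change_k.
Qed.

Program Definition Def_induced : pstrans (Def G) (Def H) :=
  {| tob := def_tob; tnat := def_tnat |}.
Next Obligation. by move=> *; apply: def_hom_ext; apply: tnat_nat. Qed.
Next Obligation. by move=> *; apply: def_hom_ext; apply: tnat1. Qed.
Next Obligation. by move=> *; apply: def_hom_ext; apply: tnatM. Qed.

End Induced.

Lemma subgroup1_map (A B : groupoid) (T : functor A B) (X : A) (g : hom X X) :
  sgset (subgroup1 X) g -> sgset (subgroup1 (T X)) (fmap T g).
Proof. by move=> /= ->; exact: fmap1. Qed.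

Definition Def_star_induced (M N : prestack Art) (F : pstrans M N) (X : M art_k) :
    pstrans (Def_star X) (Def_star (F art_k X)) :=
  Def_induced (@subgroup1_map _ _ (F art_k) X).

(* The first clause says that Aut(X) -> Aut(F(X)), which is a homomorphism,
   restricts to an isomorphism of G onto its image. *)
Definition equivariant (M N : prestack Art) (F : pstrans M N) (X : M art_k)
    (G : subgroup X) : Prop :=
  set_bij G (subgroup_image (F art_k) G) (fun g : hom X X => fmap (F art_k) g) /\
  forall g, sgset G g -> forall R : Art,
    functor_comp (Def_star_induced F X R) (Def_act g R)
    = functor_comp (Def_act (fmap (F art_k) g) R) (Def_star_induced F X R).

End Art.

(* Main.v *)
Require Import Defs.
From mathcomp Require Import all_boot all_order all_algebra.
From mathcomp Require Import boolp classical_sets functions.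
Import Defs.

Set Implicit Arguments.
Unset Strict Implicit.
Unset Printing Implicit Defensive.

(** The equivalence is the transformation induced by F itself, sending (x, i) to
    F x marked by F i and the base change comparison of F. Being an equivalence
    can be tested one algebra R at a time: a transformation of prestacks which
    is fully faithful and essentially surjective over each R is an equivalence
    ([levelwise_equivalence]), and conversely ([equivalence_faithful],
    [equivalence_full], [equivalence_ess_surj]).

    Now let F induce an equivalence on the starred functors. Essential
    surjectivity is inherited by the G-versions because they have the same
    objects and more morphisms. For full faithfulness, a G-morphism from (x, i)
    to (y, j) is the same thing as an element g of G together with a starred
    morphism from (x, g i) to (y, j) having the same underlying map
    ([def_star_of], [def_of_star]); that is, the morphisms of Def^G are those of
    the starred functor twisted by the action of G. The functor respects this
    description, the twist g becoming F g. So a morphism of the image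
    deformation functor lifts because its twist has the form F g, and the lift
    is unique because F is injective on G: two G-morphisms with the same image
    have twists with the same image, hence the same twist, and they are then
    compared as starred morphisms with a common source. *)

(** * Groupoids and fully faithful functors *)

Section Groupoids.
Variable A : groupoid.

Lemma comp_ginvK (x y z : A) (f : hom x y) (h : hom x z) :
  h <o> ginv f <o> f = h.
Proof. by rewrite -compA ginvl compm1. Qed.

Lemma ginv_compK (x y z : A) (f : hom x y) (h : hom z y) :
  f <o> (ginv f <o> h) = h.
Proof. by rewrite compA ginvr comp1m. Qed.

Lemma comp_injl (x y z : A) (h : hom y z) (f g : hom x y) :
  h <o> f = h <o> g -> f = g.
Proof. by move=> E; rewrite -[f]comp1m -(ginvl h) -compA E compA ginvl comp1m. Qed.

Lemma comp_injr (x y z : A) (h : hom x y) (f g : hom y z) :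
  f <o> h = g <o> h -> f = g.
Proof. by move=> E; rewrite -[f]compm1 -(ginvr h) compA E -compA ginvr compm1. Qed.

End Groupoids.

Definition faithful (A B : category) (T : functor A B) : Prop :=
  forall (x y : A) (u v : hom x y), fmap T u = fmap T v -> u = v.

Definition full (A B : category) (T : functor A B) : Prop :=
  forall (x y : A) (w : hom (T x) (T y)), exists u : hom x y, fmap T u = w.

Definition ess_surj (A B : category) (T : functor A B) : Prop :=
  forall y : B, inhabited {x : A & hom (T x) y}.

(** * Equivalences of prestacks are detected levelwise *)

Section LevelwiseOfEquivalence.
Variable C : category.

(** The modification makes u a conjugate of S (T u), which T u determines. *)
Lemma modification_id_faithful (P Q : prestack C) (T : pstrans P Q) (S : pstrans Q P)
    (a : modification (pstrans_comp S T) (pstrans_id P)) (R : C) :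
  faithful (T R).
Proof.
move=> x y u v uv; apply: (@comp_injr _ _ _ _ (mob a x)).
by rewrite -!(mob_nat a) /= uv.
Qed.

Variables P Q : prestack C.

Lemma equivalence_faithful (T : pstrans P Q) (R : C) :
  is_equivalence T -> faithful (T R).
Proof. by case=> S [[a] _]; exact: modification_id_faithful a R. Qed.

Lemma equivalence_ess_surj (T : pstrans P Q) (R : C) :
  is_equivalence T -> ess_surj (T R).
Proof. by case=> S [_ [b]] y; constructor; exists (S R y); exact: (mob b y). Qed.

(** The candidate for a lift of w is S w conjugated by the unit; it and w have the
    same image under S, which is faithful because T is a quasi-inverse of S. *)
Lemma equivalence_full (T : pstrans P Q) (R : C) :
  is_equivalence T -> full (T R).
Proof.
case=> S [[a] [b]] x y w.
exists (mob a y <o> fmap (S R) w <o> ginv (mob a x)).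
apply: (modification_id_faithful b); apply: (@comp_injl _ _ _ _ (mob a y)).
apply: etrans (mob_nat a _) _ => /=; exact: comp_ginvK.
Qed.

End LevelwiseOfEquivalence.

Section EquivalenceOfLevelwise.
Variables (C : category) (P Q : prestack C) (T : pstrans P Q).
Hypothesis faithfulT : forall R, faithful (T R).
Hypothesis fullT : forall R, full (T R).
Hypothesis ess_surjT : forall R, ess_surj (T R).

Definition qi_ob (R : C) (y : Q R) : P R :=
  projT1 (inhabited_witness (ess_surjT y)).

Definition qi_counit (R : C) (y : Q R) : hom (T R (qi_ob y)) y :=
  projT2 (inhabited_witness (ess_surjT y)).

Definition preim (R : C) (x y : P R) (w : hom (T R x) (T R y)) : hom x y :=
  projT1 (cid (fullT w)).

Lemma preimK (R : C) (x y : P R) (w : hom (T R x) (T R y)) :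
  fmap (T R) (preim w) = w.
Proof. exact: projT2 (cid (fullT w)). Qed.

Definition qi_map (R : C) (y z : Q R) (u : hom y z) : hom (qi_ob y) (qi_ob z) :=
  preim (ginv (qi_counit z) <o> (u <o> qi_counit y)).

Definition qi_tnat (R S : C) (f : hom R S) (y : Q R) :
    hom (pmap P f (qi_ob y)) (qi_ob (pmap Q f y)) :=
  preim (ginv (qi_counit (pmap Q f y))
    <o> (fmap (pmap Q f) (qi_counit y) <o> ginv (tnat T f (qi_ob y)))).

(** This square and the next say that the counit is natural and compatible with
    base change; as T is faithful they determine [qi_map] and [qi_tnat], and every
    coherence law below is read off from them. *)
Lemma qi_map_counit (R : C) (y z : Q R) (u : hom y z) :
  qi_counit z <o> fmap (T R) (qi_map u) = u <o> qi_counit y.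
Proof. by rewrite preimK ginv_compK. Qed.

Lemma qi_tnat_counit (R S : C) (f : hom R S) (y : Q R) :
  qi_counit (pmap Q f y) <o> fmap (T S) (qi_tnat f y) <o> tnat T f (qi_ob y)
  = fmap (pmap Q f) (qi_counit y).
Proof. by rewrite preimK ginv_compK comp_ginvK. Qed.

Lemma faithful_counit (R : C) (x : P R) (y : Q R) (u v : hom x (qi_ob y)) :
  qi_counit y <o> fmap (T R) u = qi_counit y <o> fmap (T R) v -> u = v.
Proof. by move=> /comp_injl /faithfulT. Qed.

Lemma qi_map1 (R : C) (y : Q R) : qi_map (idm y) = idm (qi_ob y).
Proof. by apply: faithful_counit; rewrite qi_map_counit fmap1 comp1m compm1. Qed.

Lemma qi_mapM (R : C) (x y z : Q R) (v : hom y z) (u : hom x y) :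
  qi_map (v <o> u) = qi_map v <o> qi_map u.
Proof.
apply: faithful_counit.
by rewrite fmapM compA !qi_map_counit -!compA qi_map_counit.
Qed.

Definition qi_functor (R : C) : functor (Q R) (P R) :=
  Functor (@qi_map1 R) (@qi_mapM R).

Lemma qi_tnat_nat (R S : C) (f : hom R S) (x y : Q R) (phi : hom x y) :
  qi_tnat f y <o> fmap (pmap P f) (fmap (qi_functor R) phi)
  = fmap (qi_functor S) (fmap (pmap Q f) phi) <o> qi_tnat f x.
Proof.
apply: faithful_counit; apply: (@comp_injr _ _ _ _ (tnat T f (qi_ob x))).
rewrite !fmapM [in RHS]compA qi_map_counit -!compA -tnat_nat /=.
rewrite [LHS]compA [LHS]compA qi_tnat_counit.
rewrite [in RHS](compA (qi_counit _)) qi_tnat_counit -!fmapM.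
by rewrite qi_map_counit.
Qed.

Lemma qi_tnat1 (R : C) (y : Q R) :
  fmap (qi_functor R) (punit y) <o> qi_tnat (idm R) y = punit (qi_functor R y).
Proof.
apply: faithful_counit; apply: (@comp_injr _ _ _ _ (tnat T (idm R) (qi_ob y))).
rewrite fmapM compA qi_map_counit -!compA tnat1.
by rewrite (compA (qi_counit _)) qi_tnat_counit punit_nat.
Qed.

Lemma qi_tnatM (R S U : C) (g : hom S U) (f : hom R S) (y : Q R) :
  qi_tnat (g <o> f) y <o> pcomp g f (qi_functor R y)
  = fmap (qi_functor U) (pcomp g f y)
      <o> (qi_tnat g (pmap Q f y) <o> fmap (pmap P g) (qi_tnat f y)).
Proof.
apply: faithful_counit.
apply: (@comp_injr _ _ _ _
  (tnat T g (pmap P f (qi_ob y)) <o> fmap (pmap Q g) (tnat T f (qi_ob y)))).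
rewrite !fmapM -!compA -tnatM.
rewrite [LHS]compA [LHS]compA qi_tnat_counit -pcomp_nat.
rewrite [in RHS](compA (qi_counit _)) qi_map_counit -!compA; congr (_ <o> _).
rewrite (compA (fmap (T U) (fmap _ _))) -tnat_nat.
by rewrite !compA qi_tnat_counit -!fmapM qi_tnat_counit.
Qed.

Definition quasi_inverse : pstrans Q P :=
  Pstrans qi_tnat_nat qi_tnat1 qi_tnatM.

Definition qi_unit (R : C) (x : P R) : hom (qi_ob (T R x)) x :=
  preim (qi_counit (T R x)).

Lemma qi_unit_nat (R : C) (x y : P R) (phi : hom x y) :
  qi_unit y <o> qi_map (fmap (T R) phi) = phi <o> qi_unit x.
Proof. by apply: faithfulT; rewrite !fmapM !preimK ginv_compK. Qed.

Lemma qi_unit_tnat (R S : C) (f : hom R S) (x : P R) :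
  qi_unit (pmap P f x) <o> (qi_map (tnat T f x) <o> qi_tnat f (T R x))
  = fmap (pmap P f) (qi_unit x).
Proof.
apply: faithfulT; apply: (@comp_injr _ _ _ _ (tnat T f (qi_ob (T R x)))).
rewrite -tnat_nat [in RHS]preimK 2!fmapM (@preimK _ _ _ (qi_counit _)).
by rewrite !compA qi_map_counit -2!compA (compA (qi_counit _)) qi_tnat_counit.
Qed.

(** Choosing preimages of objects up to isomorphism gives an inverse over each R
    separately; full faithfulness makes these choices cohere under base change. *)
Lemma levelwise_equivalence : is_equivalence T.
Proof.
exists quasi_inverse; split; constructor.
  apply: (@Modification _ _ _ (pstrans_comp quasi_inverse T) (pstrans_id P)
            qi_unit); first exact: qi_unit_nat.
  by move=> R S f x; rewrite [RHS]comp1m; exact: qi_unit_tnat.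
apply: (@Modification _ _ _ (pstrans_comp T quasi_inverse) (pstrans_id Q)
          qi_counit); first exact: qi_map_counit.
by move=> R S f y; rewrite [RHS]comp1m [LHS]compA; exact: qi_tnat_counit.
Qed.

End EquivalenceOfLevelwise.

(** * Morphisms of Def^G as twisted starred morphisms *)

Section Twist.
Variables (L : comNzRingType) (k : fieldType) (str_k : {rmorphism L -> k}).
Variables (M : prestack (Art str_k)) (X : M (art_k str_k)).
Variable R : Art str_k.

Definition twist (g : hom X X) (x : def_obj X R) : def_obj X R :=
  Def_act g R x.

Lemma def_star_map_iota (x y : def_obj X R) (u : def_hom (subgroup1 X) x y) :
  def_iota y <o> fmap (pmap M (to_k R)) (def_map u) = def_iota x.
Proof. by case: (def_mapP u) => _ -> ->; rewrite comp1m. Qed.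

(** With [def_of_star]: an element g of G relating the markings of x and y is
    absorbed into the marking of x. *)
Lemma def_star_of (g : hom X X) (x y : def_obj X R)
    (u : hom (def_val x) (def_val y)) :
  def_iota y <o> fmap (pmap M (to_k R)) u = g <o> def_iota x ->
  exists v : def_hom (subgroup1 X) (twist g x) y, def_map v = u.
Proof.
move=> E; suff uP : exists2 h, sgset (subgroup1 X) h &
    def_iota y <o> fmap (pmap M (to_k R)) u = h <o> def_iota (twist g x).
  by exists (@DefHom _ _ _ _ _ _ _ (twist g x) y u uP).
by exists (idm X); rewrite ?comp1m.
Qed.

Lemma def_of_star (G : subgroup X) (g : hom X X) (x y : def_obj X R)
    (v : def_hom (subgroup1 X) (twist g x) y) :
  sgset G g -> exists u : def_hom G x y, def_map u = def_map v.
Proof.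
move=> Gg; suff vP : exists2 h, sgset G h &
    def_iota y <o> fmap (pmap M (to_k R)) (def_map v) = h <o> def_iota x.
  by exists (@DefHom _ _ _ _ _ _ _ x y (def_map v) vP).
by exists g => //; exact: def_star_map_iota v.
Qed.

End Twist.

(** * The G-deformation functors *)

Section Induced.
Variables (L : comNzRingType) (k : fieldType) (str_k : {rmorphism L -> k}).
Variables (M N : prestack (Art str_k)) (F : pstrans M N).
Variables (X : M (art_k str_k)) (G : subgroup X).

Let Fk := F (art_k str_k).

Lemma subgroup_image_map (g : hom X X) :
  sgset G g -> sgset (subgroup_image Fk G) (fmap Fk g).
Proof. by move=> Gg; exists g. Qed.

Definition Def_image_induced : pstrans (Def G) (Def (subgroup_image Fk G)) :=
  Def_induced subgroup_image_map.

Lemma Def_image_ess_surj (R : Art str_k) :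
  ess_surj (Def_star_induced F X R) -> ess_surj (Def_image_induced R).
Proof.
move=> es y; have [[x v]] := es y; constructor; exists x.
apply: (@DefHom _ _ _ _ _ _ _ _ _ (def_map v)); exists (idm _); first exact: sg1.
by rewrite comp1m; exact: def_star_map_iota v.
Qed.

(** The twist of a G-morphism is determined by its underlying map, so twists of
    morphisms with the same image have the same image, hence agree. *)
Lemma Def_image_faithful (R : Art str_k) :
  set_inj G (fun g : hom X X => fmap Fk g) ->
  faithful (Def_star_induced F X R) -> faithful (Def_image_induced R).
Proof.
move=> injG ff x y u v /(congr1 (@def_map _ _ _ _ _ _ _ _ _)) /= uv.
have [g Gg gu] := def_mapP u; have [h Gh hv] := def_mapP v.
have gh : g = h.
  apply: injG; rewrite ?inE //.
  apply: (@comp_injr _ _ _ _ (fmap Fk (def_iota x) <o> tnat F (to_k R) _)).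
  by rewrite !compA -!fmapM -gu -hv !fmapM -!compA -!tnat_nat uv.
subst h; have [u' u'E] := def_star_of gu; have [v' v'E] := def_star_of hv.
have uv' : u' = v' by apply: ff; apply: def_hom_ext; rewrite /= u'E v'E.
by apply: def_hom_ext; rewrite -u'E uv' v'E.
Qed.

Lemma Def_image_full (R : Art str_k) :
  full (Def_star_induced F X R) -> full (Def_image_induced R).
Proof.
move=> fl x y w; have [_ [g Gg <-] gw] := def_mapP w.
(* The starred functor sends the g-twist of x to the F g-twist of F x, so w is
   starred when viewed as a map out of the image of the g-twist. *)
have wP : exists2 h, sgset (subgroup1 (Fk X)) h &
    def_iota (Def_star_induced F X R y)
      <o> fmap (pmap N (to_k R)) (def_map w)
    = h <o> def_iota (Def_star_induced F X R (twist g x)).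
  by exists (idm _) => //; rewrite comp1m /= fmapM -[in RHS]compA; exact: gw.
have [v vE] := fl (twist g x) y (@DefHom _ _ _ _ _ _ _
  (Def_star_induced F X R (twist g x)) (Def_star_induced F X R y) _ wP).
have [u uE] := def_of_star v Gg; exists u; apply: def_hom_ext.
by move/(congr1 (@def_map _ _ _ _ _ _ _ _ _)): vE => /= <-; rewrite uE.
Qed.

End Induced.

Theorem lemma3p3 (p : nat) (L : comNzRingType) (k : fieldType)
    (str_k : {rmorphism L -> k}) (char_k : p \in [pchar k]%R)
    (M N : prestack (Art str_k)) (F : pstrans M N)
    (X : M (art_k str_k)) (G : subgroup X) :
  is_equivalence (Def_star_induced F X) ->
  equivariant F G ->
  equivalent (Def G) (Def (subgroup_image (F (art_k str_k)) G)).
Proof.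
move=> eqF [[_ injG _] _]; exists (Def_image_induced F G).
apply: levelwise_equivalence => R.
- exact: Def_image_faithful injG (equivalence_faithful eqF).
- exact: Def_image_full (equivalence_full eqF).
- exact: Def_image_ess_surj (equivalence_ess_surj eqF).
Qed.
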